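(* Let $I\subset\mathbb{R}$ be an interval, let $V:I\to\mathbb{C}$ and $\alpha:I\to\mathbb{R}$ be sufficiently smooth, and set $U=\operatorname{Re}V-\alpha^2-\alpha'$. Assume that $U<0$ on $I$. Let $T:I\to\mathbb{R}$ be a differentiable function with $T\ge 1$, define $$\beta=\frac{\sqrt{|U|}}{2}\Big(T+\frac1T\Big),\qquad R=\frac{\sqrt{|U|}}{2}\Big(T-\frac1T\Big),\qquad \mathfrak{D}=2\alpha U+\frac{U'}{2}+\beta\,\operatorname{Im}V ,$$ and assume that $T$ satisfies on $I$ the differential inequality $$\frac{T'}{T}\ \ge\ \left|\frac{\mathfrak{D}}{U}\right|-\frac{\operatorname{Im}V}{\sqrt{|U|}}\,\frac{T^2-1}{2\,T}.$$ Then the circle centered at $m(u)=\alpha(u)+i\beta(u)$ with radius $R(u)$ is invariant on $I$ under the Riccati flow $y'=V-y^2$.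
   Context: The circles with center $m(u)\in\mathbb{C}$ and radius $R(u)\ge 0$ are called invariant on $I$ under the Riccati flow if for every complex-valued solution $y$ of $y'=V-y^2$ and all $u_0,u_1\in I$ with $u_1>u_0$, the inequality $|y(u_0)-m(u_0)|\le R(u_0)$ implies $|y(u_1)-m(u_1)|\le R(u_1)$. *)

(* Defs.v *)
From Stdlib Require Import Reals.
From Coquelicot Require Import Coquelicot.
Open Scope R_scope.

Definition is_interval (I : R -> Prop) : Prop :=
  forall x y z : R, I x -> I z -> x <= y <= z -> I y.

(** Derivative relative to [I]: two-sided at interior points of the interval
    [I], one-sided at an endpoint belonging to [I].  Functions on [I] are
    represented by total functions whose values off [I] are irrelevant. *)
Definition is_derive_on {W : NormedModule R_AbsRing}
  (I : R -> Prop) (f : R -> W) (u : R) (l : W) : Prop :=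
  filterdiff f (within I (locally u)) (fun h : R => scal h l).

Definition ex_derive_on {W : NormedModule R_AbsRing}
  (I : R -> Prop) (f : R -> W) (u : R) : Prop :=
  exists l : W, is_derive_on I f u l.

(** [C] is taken as a real normed space: [y] depends on a real variable. *)
Definition riccati_solution (J : R -> Prop) (V y : R -> C) : Prop :=
  forall u : R, J u ->
    is_derive_on (W := C_R_NormedModule) J y u (V u - y u * y u)%C.

(** Solutions may blow up inside [I], so [y] is only required to solve the
    equation on some subinterval [J] containing [u0] and [u1]; [J = I] is
    allowed. *)
Definition invariant_circles (I : R -> Prop) (V m : R -> C) (r : R -> R)
  : Prop :=
  (forall u : R, I u -> 0 <= r u) /\
  forall (J : R -> Prop) (y : R -> C),
    is_interval J -> (forall u : R, J u -> I u) -> riccati_solution J V y ->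
    forall u0 u1 : R, J u0 -> J u1 -> u0 < u1 ->
      Cmod (y u0 - m u0)%C <= r u0 -> Cmod (y u1 - m u1)%C <= r u1.

(** In what follows [dalpha], [dU] stand for the derivatives of [alpha], [U]. *)
Definition riccati_U (V : R -> C) (alpha dalpha : R -> R) (u : R) : R :=
  Re (V u) - alpha u ^ 2 - dalpha u.

Definition riccati_beta (U T : R -> R) (u : R) : R :=
  sqrt (Rabs (U u)) / 2 * (T u + 1 / T u).

Definition riccati_radius (U T : R -> R) (u : R) : R :=
  sqrt (Rabs (U u)) / 2 * (T u - 1 / T u).

Definition riccati_D (V : R -> C) (alpha U dU beta : R -> R) (u : R) : R :=
  2 * alpha u * U u + dU u / 2 + beta u * Im (V u).

(* Main.v *)
Require Import Defs.
From Stdlib Require Import Reals Lra.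
From Coquelicot Require Import Coquelicot.
Open Scope R_scope.

(** Let [y] solve the Riccati equation, write [y - m = p + i q],
    [rho = |y - m|], and measure the violation of the inclusion by
    [w = rho - R].  The theorem says that [w] cannot become positive.

    Put [d = D / U] and let [G] be [T'/T] plus the term in [Im V] from the
    differential inequality, so that the hypothesis reads [|d| <= G].  Since
    [beta^2 - R^2 = |U|], differentiating [beta] and [R] gives
    [beta' = d beta - 2 alpha beta + Im V + R G] and
    [R' = d R - 2 alpha R + beta G]: both are driven by the same two
    quantities.  Inserting this into the Riccati equation yields the identity

      [rho w' = - (2 alpha rho + p (rho + R)) w
                - d (beta q + R rho) - G (R q + beta rho)].

    As [|q| <= rho] and [R <= beta], the products [(beta - R) (rho - q)] and
    [(beta + R) (rho + q)] are nonnegative, that is,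
    [|beta q + R rho| <= R q + beta rho].  Together with [|d| <= G] this makes
    the last two terms nonpositive in total ([distance_rate_le]).  Where
    [w > 0], the first term is at most [(2 |p| - 2 alpha) rho w], so
    [w' <= k w] with [k] continuous, and a Gronwall argument keeps [w]
    nonpositive ([nonpos_of_linear_growth_where_pos]).

    Using [rho - R] rather than [rho^2 - R^2] matters: [d] and [G] may be
    unbounded, because [U'] and [T'] need not be continuous, and they cancel
    only in [w'].  The function [w] may fail to be differentiable where
    [rho = 0], but [R >= 0] excludes this wherever [w > 0]. *)

(** * Derivatives relative to an interval *)

Lemma locally_open_interval (a b x : R) :
  a < x < b -> locally x (fun t => a < t < b).
Proof.
  apply (open_and (fun t => a < t) (fun t => t < b)); [apply open_gt | apply open_lt].
Qed.

(** The interval is a neighbourhood of its interior points, so the filter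
    [within J (locally x)] is [locally x] there. *)
Lemma is_derive_on_interior {W : NormedModule R_AbsRing}
  (J : R -> Prop) (f : R -> W) (a b x : R) (l : W) :
  is_interval J -> J a -> J b -> a < x < b ->
  is_derive_on J f x l -> is_derive f x l.
Proof.
  intros HJ Ha Hb Hx [Hlin Hdom].
  assert (Hwithin : filter_le (locally x) (within J (locally x))).
  { intros P HP.
    generalize (filter_and (F := locally x) _ _ HP (locally_open_interval a b x Hx)).
    apply filter_imp.
    intros t [HPt Ht]. apply HPt. apply (HJ a t b); try assumption; lra. }
  split; [exact Hlin|].
  intros z Hz eps. apply Hwithin. apply Hdom.
  intros P HP. apply filter_le_within, Hz, HP.
Qed.

Lemma is_derive_on_continuous {W : NormedModule R_AbsRing}
  (J : R -> Prop) (f : R -> W) (x : R) (l : W) :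
  is_derive_on J f x l -> filterlim f (within J (locally x)) (locally (f x)).
Proof.
  intros Hf.
  apply (filterdiff_continuous_aux (K := R_AbsRing) (U := R_NormedModule)).
  - exists (fun h : R => scal h l). exact Hf.
  - intros P HP. apply filter_le_within, HP.
Qed.

(** Composing with [clamp a b] turns continuity relative to an interval into
    continuity on the whole line without changing values on [[a, b]].  This
    gives access to the extreme value and mean value theorems, which want
    two-sided continuity also at the endpoints. *)
Definition clamp (a b t : R) : R := Rmax a (Rmin t b).

Lemma clamp_bounds (a b t : R) : a <= b -> a <= clamp a b t <= b.
Proof. intros H. unfold clamp, Rmax, Rmin. repeat destruct Rle_dec; lra. Qed.

Lemma clamp_id (a b t : R) : a <= t <= b -> clamp a b t = t.
Proof. intros H. unfold clamp, Rmax, Rmin. repeat destruct Rle_dec; lra. Qed.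

Lemma continuous_clamp {W : UniformSpace} (J : R -> Prop) (f : R -> W) (a b : R) :
  is_interval J -> J a -> J b -> a <= b ->
  (forall x, J x -> filterlim f (within J (locally x)) (locally (f x))) ->
  forall x, continuous (fun t => f (clamp a b t)) x.
Proof.
  intros HJ Ha Hb Hab Hf x.
  assert (HJc : forall t, J (clamp a b t)).
  { intros t. apply (HJ a _ b); auto. now apply clamp_bounds. }
  apply (filterlim_comp _ _ _ (clamp a b) f _ (within J (locally (clamp a b x)))).
  - intros P [eps HP]. exists eps. intros t Ht. apply HP; [|apply HJc].
    change (Rabs (clamp a b t - clamp a b x) < eps).
    change (Rabs (t - x) < eps) in Ht.
    apply Rabs_def2 in Ht. apply Rabs_def1;
    unfold clamp, Rmax, Rmin; repeat destruct Rle_dec; lra.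
  - apply Hf, HJc.
Qed.

(** * Derivatives of components, norms and square roots *)

Lemma is_derive_fst (f : R -> C) (x : R) (l : C) :
  is_derive (V := C_R_NormedModule) f x l ->
  is_derive (fun t => fst (f t)) x (fst l).
Proof.
  intros Hf.
  apply (filterdiff_ext_lin _ (fun h : R => fst (scal (V := C_R_NormedModule) h l))).
  - apply (filterdiff_comp' (V := C_R_NormedModule) f (fun z => fst z) x _ (fun z => fst z)).
    + exact Hf.
    + apply filterdiff_linear, (is_linear_fst (U := R_NormedModule) (V := R_NormedModule)).
  - reflexivity.
Qed.

Lemma is_derive_snd (f : R -> C) (x : R) (l : C) :
  is_derive (V := C_R_NormedModule) f x l ->
  is_derive (fun t => snd (f t)) x (snd l).
Proof.
  intros Hf.
  apply (filterdiff_ext_lin _ (fun h : R => snd (scal (V := C_R_NormedModule) h l))).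
  - apply (filterdiff_comp' (V := C_R_NormedModule) f (fun z => snd z) x _ (fun z => snd z)).
    + exact Hf.
    + apply filterdiff_linear, (is_linear_snd (U := R_NormedModule) (V := R_NormedModule)).
  - reflexivity.
Qed.

Lemma is_derive_sqrt_abs (U : R -> R) (x dU : R) :
  is_derive U x dU -> U x < 0 ->
  is_derive (fun t => sqrt (Rabs (U t))) x (- dU / (2 * sqrt (Rabs (U x)))).
Proof.
  intros HU Hneg.
  replace (- dU) with (sign (U x) * dU) by (rewrite sign_eq_m1 by exact Hneg; ring).
  apply (is_derive_sqrt (fun t => Rabs (U t)) x (sign (U x) * dU)).
  - apply is_derive_Rabs; [exact HU | lra].
  - apply Rabs_pos_lt. lra.
Qed.

Lemma is_derive_norm_minus (f g h : R -> R) (x df dg dh : R) :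
  is_derive f x df -> is_derive g x dg -> is_derive h x dh ->
  0 < f x ^ 2 + g x ^ 2 ->
  is_derive (fun t => sqrt (f t ^ 2 + g t ^ 2) - h t) x
    ((f x * df + g x * dg) / sqrt (f x ^ 2 + g x ^ 2) - dh).
Proof.
  intros Hf Hg Hh Hpos. assert (Hs := sqrt_lt_R0 _ Hpos).
  auto_derive.
  - repeat split; try (eexists; eassumption). simpl in Hpos. exact Hpos.
  - rewrite (is_derive_unique (fun t : R => f t) _ _ Hf).
    rewrite (is_derive_unique (fun t : R => g t) _ _ Hg).
    rewrite (is_derive_unique (fun t : R => h t) _ _ Hh).
    simpl in *. field. lra.
Qed.

(** * One-sided comparison *)

(** If [f b > 0], let [s] be the last point of [[a, b]] where [f <= 0].
    To the right of [s] the function is positive, hence nonincreasing, which contradicts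
    [f s <= 0 < f b]. *)
Lemma nonpos_of_decreasing_where_pos (f : R -> R) (a b : R) :
  a < b -> (forall x, continuous f x) -> f a <= 0 ->
  (forall x, a < x < b -> 0 < f x -> exists l, is_derive f x l /\ l <= 0) ->
  f b <= 0.
Proof.
  intros Hab Hc Ha Hd. apply Rnot_lt_le. intros Hb.
  destruct (completeness (fun x => a <= x <= b /\ f x <= 0)) as [s [Hub Hlub]].
  { exists b. intros x Hx. lra. }
  { exists a. lra. }
  assert (Has : a <= s) by (apply Hub; lra).
  assert (Hsb : s <= b) by (apply Hlub; intros x Hx; lra).
  assert (Hpos : forall x, s < x <= b -> 0 < f x).
  { intros x Hx. apply Rnot_le_lt. intros Hfx.
    assert (x <= s) by (apply Hub; lra). lra. }
  assert (Hs : f s <= 0).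
  { apply Rnot_lt_le. intros Hfs.
    destruct (Hc s (fun y => 0 < y)) as [eps Heps].
    { apply open_gt. exact Hfs. }
    (* Positivity near [s] would make [s - eps] an upper bound already. *)
    assert (s <= s - eps); [|destruct eps; simpl in *; lra].
    apply Hlub. intros x [Hx Hfx]. apply Rnot_lt_le. intros Hlt.
    assert (x <= s) by (apply Hub; lra).
    assert (0 < f x); [|lra].
    apply Heps. change (Rabs (x - s) < eps). apply Rabs_def1; destruct eps; simpl in *; lra. }
  assert (s < b) by (destruct (Req_dec s b); [subst; lra | lra]).
  (* The mean value theorem may return an endpoint, where nothing is known
     about [Derive f]; truncating at [0] fixes the sign there and changes
     nothing in the interior. *)
  destruct (MVT_gen f s b (fun x => Rmin (Derive f x) 0)) as [c [_ Hfc]].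
  - rewrite Rmin_left, Rmax_right by lra. intros x Hx.
    destruct (Hd x) as [l [Hl Hl0]]; [lra | apply Hpos; lra|].
    rewrite (is_derive_unique _ _ _ Hl), Rmin_left; assumption.
  - intros x _. apply continuity_pt_filterlim, Hc.
  - generalize (Rmin_r (Derive f c) 0). nra.
Qed.

(** This is Gronwall's inequality, needed only where [w > 0]: with [K] the maximum of [k]
    on [[a, b]], the product [w exp (- K t)] is nonincreasing where it is
    positive. *)
Lemma nonpos_of_linear_growth_where_pos (w k : R -> R) (a b : R) :
  a < b ->
  (forall x, continuous (fun t => w (clamp a b t)) x) ->
  (forall x, continuous (fun t => k (clamp a b t)) x) ->
  w a <= 0 ->
  (forall x, a < x < b -> 0 < w x -> exists l, is_derive w x l /\ l <= k x * w x) ->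
  w b <= 0.
Proof.
  intros Hab Hw Hk Ha Hd.
  destruct (continuity_ab_maj (fun t => k (clamp a b t)) a b) as [M [HM _]].
  { lra. }
  { intros c _. apply continuity_pt_filterlim, Hk. }
  set (K := k (clamp a b M)) in HM.
  assert (HF : w (clamp a b b) * exp (- K * b) <= 0).
  { apply (nonpos_of_decreasing_where_pos
             (fun t => w (clamp a b t) * exp (- K * t)) a b Hab).
    - intros x. apply (continuous_mult (K := R_AbsRing)).
      + apply Hw.
      + apply continuous_exp_comp.
        apply (continuous_scal_r (K := R_AbsRing) (V := R_NormedModule)), continuous_id.
    - rewrite clamp_id by lra. generalize (exp_pos (- K * a)). nra.
    - intros x Hx. rewrite clamp_id by lra. intros Hpos.
      assert (Hwx : 0 < w x) by (generalize (exp_pos (- K * x)); nra).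
      destruct (Hd x Hx Hwx) as [l [Hl Hlk]].
      exists ((l - K * w x) * exp (- K * x)). split.
      + apply (is_derive_ext_loc (fun t => w t * exp (- K * t))).
        * generalize (locally_open_interval a b x Hx). apply filter_imp.
          intros t Ht. rewrite (clamp_id a b t); [reflexivity | lra].
        * auto_derive.
          { exists l. exact Hl. }
          rewrite (is_derive_unique (fun t : R => w t) _ _ Hl). ring.
      + specialize (HM x). simpl in HM. rewrite (clamp_id a b x) in HM by lra.
        generalize (exp_pos (- K * x)). intros He.
        assert (k x <= K) by (apply HM; lra).
        assert (l - K * w x <= 0) by nra. nra. }
  rewrite clamp_id in HF by lra. generalize (exp_pos (- K * b)). nra.
Qed.

(** * Rate of change of the distance to the circle *)

(** The left-hand side is [w' = (p p' + q q') / rho - r'] after all derivatives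
    have been replaced by their values ([a], [b], [r] stand for [alpha],
    [beta], [R]).  The terms in [d] and [G] add up to
    [- d (q b + rho r) - G (q r + rho b)], which is nonpositive because it is
    minus half of
    [(G + d) (b + r) (rho + q) + (G - d) (b - r) (rho - q)]. *)
Lemma distance_rate_le (p q rho r b a d G : R) :
  rho ^ 2 = p ^ 2 + q ^ 2 -> 0 <= r -> r < rho -> r <= b -> Rabs d <= G ->
  (p * (- 2 * a * p - p ^ 2 + q ^ 2 + 2 * b * q + r ^ 2)
   + q * (- (d * b + r * G) - 2 * a * q - 2 * p * (b + q))) / rho
  - (d * r - 2 * a * r + b * G)
  <= (2 * Rabs p - 2 * a) * (rho - r).
Proof.
  intros Hrho Hr Hlt Hb Hd.
  assert (Hq : - rho <= q <= rho) by nra.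
  assert (Hdrift : - d * (q * b + rho * r) <= G * (q * r + rho * b)).
  { assert (0 <= (b - r) * (rho - q)) by (apply Rmult_le_pos; lra).
    assert (0 <= (b + r) * (rho + q)) by (apply Rmult_le_pos; lra).
    apply Rabs_le_between in Hd.
    assert (0 <= (G + d) * ((b + r) * (rho + q))) by (apply Rmult_le_pos; lra).
    assert (0 <= (G - d) * ((b - r) * (rho - q))) by (apply Rmult_le_pos; lra).
    nra. }
  assert (Hp : - p * (rho + r) <= 2 * Rabs p * rho).
  { generalize (Rabs_pos p) (Rle_abs (- p)). rewrite Rabs_Ropp. nra. }
  apply Rmult_le_reg_r with rho; [lra|].
  replace (((p * (- 2 * a * p - p ^ 2 + q ^ 2 + 2 * b * q + r ^ 2)
   + q * (- (d * b + r * G) - 2 * a * q - 2 * p * (b + q))) / rho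
  - (d * r - 2 * a * r + b * G)) * rho) with
   (- (2 * a + p) * (p ^ 2 + q ^ 2) + p * r ^ 2 - q * (d * b + r * G)
    - (d * r - 2 * a * r + b * G) * rho) by (field; lra).
  rewrite <- Hrho. nra.
Qed.

(** * The centre and the radius *)

Lemma radius_bounds (U T : R -> R) (u : R) :
  1 <= T u -> 0 <= riccati_radius U T u <= riccati_beta U T u.
Proof.
  intros HT. unfold riccati_radius, riccati_beta.
  assert (Hs := sqrt_pos (Rabs (U u))).
  assert (0 < 1 / T u <= 1).
  { split; [apply Rdiv_lt_0_compat; lra|]. apply Rle_div_l; lra. }
  split; [apply Rmult_le_pos; lra | apply Rmult_le_compat_l; lra].
Qed.

Lemma sqr_beta_minus_sqr_radius (U T : R -> R) (u : R) :
  0 < T u -> riccati_beta U T u ^ 2 - riccati_radius U T u ^ 2 = Rabs (U u).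
Proof.
  intros HT. rewrite <- (pow2_sqrt (Rabs (U u))) by apply Rabs_pos.
  unfold riccati_beta, riccati_radius. field. lra.
Qed.

(** Eliminating [U'] and [T'] in favour of [d = D / U] and [G], the two
    quantities related by the differential inequality, is what makes that
    inequality usable: since [s = sqrt |U|] satisfies [s' / s = U' / (2 U)],
    one has [beta' = (U' / (2 U)) beta + (T' / T) R] and
    [R' = (U' / (2 U)) R + (T' / T) beta]. *)
Lemma is_derive_beta_radius (V : R -> C) (alpha U T : R -> R) (x dU dT : R) :
  is_derive U x dU -> is_derive T x dT -> U x < 0 -> 0 < T x ->
  let b := riccati_beta U T x in
  let r := riccati_radius U T x in
  let d := (2 * alpha x * U x + dU / 2 + b * Im (V x)) / U x in
  let G := dT / T x
    + Im (V x) / sqrt (Rabs (U x)) * ((T x ^ 2 - 1) / (2 * T x)) in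
  is_derive (riccati_beta U T) x (d * b - 2 * alpha x * b + Im (V x) + r * G) /\
  is_derive (riccati_radius U T) x (d * r - 2 * alpha x * r + b * G).
Proof.
  intros HU HT Hneg HTpos.
  generalize (is_derive_sqrt_abs U x dU HU Hneg).
  assert (Hs : 0 < sqrt (Rabs (U x))) by (apply sqrt_lt_R0, Rabs_pos_lt; lra).
  assert (Hs2 : U x = - (sqrt (Rabs (U x)) ^ 2)).
  { rewrite pow2_sqrt by apply Rabs_pos. rewrite Rabs_left by exact Hneg. ring. }
  unfold riccati_beta, riccati_radius.
  set (s := fun t => sqrt (Rabs (U t))).
  change (sqrt (Rabs (U x))) with (s x) in *.
  intros Hds. rewrite Hs2.
  split.
  - apply (is_derive_ext (fun t => s t / 2 * (T t + 1 / T t))); [reflexivity|].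
    auto_derive.
    + repeat split; try (eexists; eassumption); lra.
    + rewrite (is_derive_unique (fun t : R => s t) _ _ Hds).
      rewrite (is_derive_unique (fun t : R => T t) _ _ HT). field. lra.
  - apply (is_derive_ext (fun t => s t / 2 * (T t - 1 / T t))); [reflexivity|].
    auto_derive.
    + repeat split; try (eexists; eassumption); lra.
    + rewrite (is_derive_unique (fun t : R => s t) _ _ Hds).
      rewrite (is_derive_unique (fun t : R => T t) _ _ HT). field. lra.
Qed.

Theorem theorem3p2 (I : R -> Prop) (V : R -> C)
  (alpha dalpha dU T dT : R -> R) :
  let U := riccati_U V alpha dalpha in
  let beta := riccati_beta U T in
  let radius := riccati_radius U T in
  let D := riccati_D V alpha U dU beta in
  is_interval I ->
  (forall u : R, I u -> ex_derive_on (W := C_R_NormedModule) I V u) ->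
  (forall u : R, I u -> is_derive_on I alpha u (dalpha u)) ->
  (forall u : R, I u -> ex_derive_on I dalpha u) ->
  (forall u : R, I u -> is_derive_on I U u (dU u)) ->
  (forall u : R, I u -> U u < 0) ->
  (forall u : R, I u -> 1 <= T u) ->
  (forall u : R, I u -> is_derive_on I T u (dT u)) ->
  (forall u : R, I u ->
    dT u / T u >=
      Rabs (D u / U u)
      - Im (V u) / sqrt (Rabs (U u)) * ((T u ^ 2 - 1) / (2 * T u))) ->
  invariant_circles I V (fun u : R => (alpha u, beta u)) radius.
Proof.
  intros U beta radius D HI HV Halpha Hdalpha HU HUneg HT1 HT Hineq.
  assert (Hradius : forall u, I u -> 0 <= radius u <= beta u).
  { intros u Hu. apply radius_bounds, HT1, Hu. }
  split; [intros u Hu; apply Hradius, Hu|].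
  intros J y HJ HJI Hy u0 u1 Hu0 Hu1 Hlt Hstart.
  set (p := fun t => fst (y t) - alpha t).
  set (q := fun t => snd (y t) - beta t).
  set (w := fun t => sqrt (p t ^ 2 + q t ^ 2) - radius t).
  enough (w u1 <= 0) by (unfold w in H; change (Cmod (y u1 - (alpha u1, beta u1))%C)
    with (sqrt (p u1 ^ 2 + q u1 ^ 2)); lra).
  assert (Hw0 : w u0 <= 0).
  { change (Cmod (y u0 - (alpha u0, beta u0))%C) with (sqrt (p u0 ^ 2 + q u0 ^ 2)) in Hstart.
    unfold w. lra. }
  assert (HcI : forall (f : R -> R) (df : R -> R),
    (forall u, I u -> is_derive_on I f u (df u)) ->
    forall x, continuous (fun t => f (clamp u0 u1 t)) x).
  { intros f df Hf. apply (continuous_clamp I); auto; try lra.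
    intros x Hx. apply (is_derive_on_continuous I f x (df x)). auto. }
  assert (Hyc : forall x, continuous (fun t => y (clamp u0 u1 t)) x).
  { apply (continuous_clamp J); auto; try lra.
    intros x Hx. exact (is_derive_on_continuous J y x _ (Hy x Hx)). }
  assert (Hc1 : forall x, continuous (fun t => fst (y (clamp u0 u1 t))) x).
  { intros x. apply (continuous_comp (fun t => y (clamp u0 u1 t)) (fun z => fst z)).
    - apply Hyc.
    - apply continuous_fst. }
  assert (Hc2 : forall x, continuous (fun t => snd (y (clamp u0 u1 t))) x).
  { intros x. apply (continuous_comp (fun t => y (clamp u0 u1 t)) (fun z => snd z)).
    - apply Hyc.
    - apply continuous_snd. }
  assert (Hcalpha := HcI alpha dalpha Halpha).
  assert (HcT := HcI T dT HT).
  assert (HcU := HcI U dU HU).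
  assert (Hsc : forall x, continuous (fun t => sqrt (Rabs (U (clamp u0 u1 t))) / 2) x).
  { intros x. apply (continuous_mult (K := R_AbsRing)).
    - apply continuous_sqrt_comp, continuous_Rabs_comp, HcU.
    - apply continuous_const. }
  assert (Hone : forall x, continuous (fun t => 1 / T (clamp u0 u1 t)) x).
  { intros x. apply (continuous_mult (K := R_AbsRing)); [apply continuous_const|].
    apply continuous_Rinv_comp; [apply HcT|].
    assert (1 <= T (clamp u0 u1 x)); [|lra].
    apply HT1, (HI u0 _ u1); auto. apply clamp_bounds. lra. }
  assert (Hcbeta : forall x, continuous (fun t => beta (clamp u0 u1 t)) x).
  { intros x. apply (continuous_mult (K := R_AbsRing)); [apply Hsc|].
    apply (continuous_plus (V := R_NormedModule)); [apply HcT | apply Hone]. }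
  assert (Hcradius : forall x, continuous (fun t => radius (clamp u0 u1 t)) x).
  { intros x. apply (continuous_mult (K := R_AbsRing)); [apply Hsc|].
    apply (continuous_minus (V := R_NormedModule)); [apply HcT | apply Hone]. }
  assert (Hcp : forall x, continuous (fun t => p (clamp u0 u1 t)) x).
  { intros x. apply (continuous_minus (V := R_NormedModule)); [apply Hc1 | apply Hcalpha]. }
  assert (Hcq : forall x, continuous (fun t => q (clamp u0 u1 t)) x).
  { intros x. apply (continuous_minus (V := R_NormedModule)); [apply Hc2 | apply Hcbeta]. }
  assert (Hsquare : forall f : R -> R, (forall x, continuous f x) ->
    forall x, continuous (fun t => f t ^ 2) x).
  { intros f Hf x. apply (continuous_mult (K := R_AbsRing)); [apply Hf|].
    apply (continuous_mult (K := R_AbsRing)); [apply Hf | apply continuous_const]. }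
  apply (nonpos_of_linear_growth_where_pos w
           (fun t => 2 * Rabs (p t) - 2 * alpha t) u0 u1 Hlt).
  - intros x. apply (continuous_minus (V := R_NormedModule)); [|apply Hcradius].
    apply continuous_sqrt_comp, (continuous_plus (V := R_NormedModule));
    now apply Hsquare.
  - intros x. apply (continuous_minus (V := R_NormedModule));
    apply (continuous_mult (K := R_AbsRing)); try apply continuous_const.
    + apply continuous_Rabs_comp, Hcp.
    + apply Hcalpha.
  - exact Hw0.
  - intros x Hx Hpos.
    assert (Jx : J x) by (apply (HJ u0 x u1); auto; lra).
    assert (Ix := HJI x Jx).
    assert (HIu0 := HJI u0 Hu0). assert (HIu1 := HJI u1 Hu1).
    assert (Hda := is_derive_on_interior I alpha u0 u1 x _ HI HIu0 HIu1 Hx (Halpha x Ix)).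
    assert (HdU := is_derive_on_interior I U u0 u1 x _ HI HIu0 HIu1 Hx (HU x Ix)).
    assert (HdT := is_derive_on_interior I T u0 u1 x _ HI HIu0 HIu1 Hx (HT x Ix)).
    assert (Hdy := is_derive_on_interior J _ u0 u1 x _ HJ Hu0 Hu1 Hx (Hy x Jx)).
    assert (Hdy1 := is_derive_fst _ _ _ Hdy).
    assert (Hdy2 := is_derive_snd _ _ _ Hdy).
    specialize (HT1 x Ix). specialize (HUneg x Ix). specialize (Hradius x Ix).
    destruct (is_derive_beta_radius V alpha U T x (dU x) (dT x)) as [Hdb Hdr];
      try assumption; try lra.
    specialize (Hineq x Ix).
    change ((2 * alpha x * U x + dU x / 2 + riccati_beta U T x * Im (V x)) / U x)
      with (D x / U x) in Hdb, Hdr.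
    set (d := D x / U x) in *.
    set (G := dT x / T x + Im (V x) / sqrt (Rabs (U x)) * ((T x ^ 2 - 1) / (2 * T x))) in *.
    assert (HG : Rabs d <= G) by (unfold G; lra).
    change (riccati_beta U T) with beta in Hdb, Hdr.
    change (riccati_radius U T) with radius in Hdb, Hdr.
    (* [w x > 0] and [0 <= R] keep [y x] away from the centre, where the
       distance is not differentiable. *)
    assert (Hrho : 0 < sqrt (p x ^ 2 + q x ^ 2)) by (unfold w in Hpos; lra).
    assert (Hsq : 0 < p x ^ 2 + q x ^ 2).
    { apply Rnot_le_lt. intros Hle. rewrite sqrt_neg_0 in Hrho by exact Hle. lra. }
    assert (Hbr : beta x ^ 2 - radius x ^ 2 = - U x).
    { rewrite <- (Rabs_left (U x)) by exact HUneg.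
      apply sqr_beta_minus_sqr_radius. lra. }
    assert (Hdp := is_derive_minus (V := R_NormedModule) _ _ _ _ _ Hdy1 Hda).
    assert (Hdq := is_derive_minus (V := R_NormedModule) _ _ _ _ _ Hdy2 Hdb).
    eexists. split.
    { apply (is_derive_norm_minus p q radius x _ _ _ Hdp Hdq Hdr Hsq). }
    eapply Rle_trans; [apply Req_le|apply (distance_rate_le (p x) (q x)
      (sqrt (p x ^ 2 + q x ^ 2)) (radius x) (beta x) (alpha x) d G)].
    (* [alpha' = Re V - alpha^2 - U] and [U = R^2 - beta^2] turn the Riccati
       equation into the expressions for [p'] and [q']. *)
    + f_equal. f_equal.
      assert (Hdalpha_x : dalpha x = fst (V x) - alpha x ^ 2 - (radius x ^ 2 - beta x ^ 2)).
      { replace (radius x ^ 2 - beta x ^ 2) with (U x) by lra.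
        unfold U, riccati_U, Re. ring. }
      rewrite Hdalpha_x. unfold p, q, Im, minus, plus, opp. simpl. ring.
    + apply pow2_sqrt. lra.
    + lra.
    + unfold w in Hpos. lra.
    + lra.
    + exact HG.
Qed.
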